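(* Let $p$ be a prime, let $G$ be a finite group, and let $\chi\in\mathrm{Irr}(G)$ be such that $\chi(g^p)=\chi(g)$ for all $p$-regular elements $g\in G$. For $\psi\in\mathrm{Irr}(G)$ set $a_\psi=\langle\chi^{(p)},\psi\rangle$. Then for all $\phi\in\mathrm{IBr}(G)$, $$d_{\chi\phi}=\sum_{\psi\in\mathrm{Irr}(G)}a_\psi\,d_{\psi\phi}.$$
   Context: Fix a $p$-modular splitting system $(R,F,K)$: $R$ is a complete discrete valuation ring with quotient field $K$ of characteristic $0$ and residue field $F$ of characteristic $p$, with $K$ and $F$ splitting fields for $G$ and its subgroups. $\mathrm{Irr}(G)$ is the set of irreducible characters of $G$ over $K$ and $\mathrm{IBr}(G)$ the set of irreducible Brauer characters of $G$ (corresponding to the simple $FG$-modules). For $\chi\in\mathrm{Irr}(G)$ afforded by a $KG$-module with $R$-form $U$, the decomposition number $d_{\chi\phi}$ is the multiplicity, as a composition factor of $F\otimes_R U$, of the simple $FG$-module with Brauer character $\phi$. The class function $\chi^{(p)}$ is defined by $\chi^{(p)}(g)=\chi(g^p)$. An element of $G$ is $p$-regular if its order is not divisible by $p$. $\langle\cdot,\cdot\rangle$ is the usual scalar product of class functions. *)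

(* Defs.v *)
From HB Require Import structures.
From mathcomp Require Import all_boot all_order all_fingroup all_algebra.
From mathcomp Require Import all_solvable all_character.
From mathcomp Require Import boolp classical_sets fsbigop.

Set Implicit Arguments.
Unset Strict Implicit.
Unset Printing Implicit Defensive.

Import GRing.Theory.
Local Open Scope ring_scope.

(* Complete discrete valuation rings, by means of a uniformizer t: the maximal
   ideal is (t), and its k-th power consists of the multiples of t ^+ k. *)

Definition uniformizer (R : idomainType) (t : R) : Prop :=
  [/\ t != 0, t \isn't a GRing.unit &
      forall x : R, x != 0 ->
        exists (n : nat) (u : R), u \is a GRing.unit /\ x = u * t ^+ n].

Definition adic_close (R : idomainType) (t : R) (k : nat) (x y : R) : Prop :=
  exists c : R, x - y = c * t ^+ k.

Definition adic_cauchy (R : idomainType) (t : R) (u : nat -> R) : Prop :=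
  forall k : nat, exists N : nat, forall m n : nat,
    (N <= m)%N -> (N <= n)%N -> adic_close t k (u m) (u n).

Definition adic_limit (R : idomainType) (t : R) (u : nat -> R) (l : R) : Prop :=
  forall k : nat, exists N : nat, forall n : nat,
    (N <= n)%N -> adic_close t k (u n) l.

Definition complete_dvr (R : idomainType) : Prop :=
  exists t : R, uniformizer t /\
    forall u : nat -> R, adic_cauchy t u -> exists l : R, adic_limit t u l.

Record modular_system (p : nat) := ModularSystem {
  ms_R : idomainType;
  ms_F : fieldType;
  ms_K : fieldType;
  ms_emb : {rmorphism ms_R -> ms_K};
  ms_red : {rmorphism ms_R -> ms_F};
  ms_complete_dvr : complete_dvr ms_R;
  ms_emb_inj : injective ms_emb;
  ms_emb_frac : forall x : ms_K,
    exists a b : ms_R, b != 0 /\ x = ms_emb a / ms_emb b;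
  ms_red_surj : forall y : ms_F, exists x : ms_R, ms_red x = y;
  (* In a local ring the maximal ideal is the set of nonunits. *)
  ms_red_ker : forall x : ms_R, (ms_red x == 0) = (x \isn't a GRing.unit);
  ms_K_char0 : [pchar ms_K] =i pred0;
  ms_F_charp : p \in [pchar ms_F]
}.

Definition splitting_for (p : nat) (S : modular_system p)
    (gT : finGroupType) (G : {group gT}) : Prop :=
  forall H : {group gT}, H \subset G ->
    group_splitting_field (ms_K S) H /\ group_splitting_field (ms_F S) H.

(* Class functions of G are represented as functions on the ambient type that
   vanish outside their actual domain: outside G for ordinary class functions,
   outside the set of p-regular elements of G for Brauer characters. *)

Definition character_of (K : fieldType) (gT : finGroupType) (G : {group gT})
    (n : nat) (rG : mx_representation K G n) : {ffun gT -> K} :=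
  [ffun g => if g \in G then \tr (rG g) else 0].

Definition Irr (K : fieldType) (gT : finGroupType) (G : {group gT}) :
    set {ffun gT -> K} :=
  [set chi | exists (n : nat) (rG : mx_representation K G n),
     mx_irreducible rG /\ chi = character_of rG]%classic.
Arguments Irr K {gT} G.

(* Over a general K there is no complex conjugation, hence g^-1; on characters
   this is the usual Hermitian product. *)
Definition cf_dot (K : fieldType) (gT : finGroupType) (G : {group gT})
    (alpha beta : {ffun gT -> K}) : K :=
  #|G|%:R^-1 * \sum_(g in G) alpha g * beta (g^-1)%g.

Definition cf_pow (K : fieldType) (gT : finGroupType) (G : {group gT})
    (p : nat) (chi : {ffun gT -> K}) : {ffun gT -> K} :=
  [ffun g => if g \in G then chi (g ^+ p)%g else 0].

Definition p_regular (p : nat) (gT : finGroupType) (g : gT) : bool :=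
  ~~ (p %| #[g]%g)%N.

(* beta is the Brauer character of rG: at a p-regular g the eigenvalues of rG g
   are m-th roots of unity, m = #[g] being prime to p, hence reductions of
   unique m-th roots of unity in R, and beta g is the sum of these lifts. *)
Definition has_brauer_character (p : nat) (S : modular_system p)
    (gT : finGroupType) (G : {group gT}) (n : nat)
    (rG : mx_representation (ms_F S) G n) (beta : {ffun gT -> ms_K S}) : Prop :=
  (forall g : gT, g \in G -> p_regular p g ->
     exists s : seq (ms_R S),
       [/\ all (fun z => z ^+ #[g]%g == 1) s,
           char_poly (rG g) = \prod_(z <- s) ('X - (ms_red S z)%:P) &
           beta g = \sum_(z <- s) ms_emb S z]) /\
  (forall g : gT, ~~ ((g \in G) && p_regular p g) -> beta g = 0).

Definition IBr (p : nat) (S : modular_system p)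
    (gT : finGroupType) (G : {group gT}) : set {ffun gT -> ms_K S} :=
  [set phi | exists (n : nat) (rL : mx_representation (ms_F S) G n),
     mx_irreducible rL /\ has_brauer_character rL phi]%classic.
Arguments IBr {p} S {gT} G.

(* The simple module of rL has multiplicity d as a composition factor of the
   module of rW; by Jordan-Hoelder d does not depend on the series V. *)
Definition composition_multiplicity (F : fieldType) (gT : finGroupType)
    (G : {group gT}) (n : nat) (rW : mx_representation F G n)
    (m : nat) (rL : mx_representation F G m) (d : nat) : Prop :=
  exists (V : seq 'M[F]_n) (compV : mx_composition_series rW V),
    (last 0 V :=: 1%:M)%MS /\
    d = #|[pred i : 'I_(size V) | `[< mx_rsim (series_repr i compV) rL >]]|.

(* rU is an R-form of a KG-module affording chi: a representation of G by
   matrices over R whose extension of scalars to K has character chi. *)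
Definition R_form_of (p : nat) (S : modular_system p)
    (gT : finGroupType) (G : {group gT}) (chi : {ffun gT -> ms_K S})
    (n : nat) (rU : mx_representation (ms_R S) G n) : Prop :=
  character_of (map_repr (ms_emb S) rU) = chi.

Definition is_decomposition_number (p : nat) (S : modular_system p)
    (gT : finGroupType) (G : {group gT})
    (chi phi : {ffun gT -> ms_K S}) (d : nat) : Prop :=
  exists (n : nat) (rU : mx_representation (ms_R S) G n)
         (m : nat) (rL : mx_representation (ms_F S) G m),
    [/\ R_form_of chi rU, mx_irreducible rL, has_brauer_character rL phi &
        composition_multiplicity (map_repr (ms_red S) rU) rL d].

(* For chi in Irr and phi in IBr the number d exists and is unique; 0 is a
   default value for other arguments. *)
Definition decomposition_number (p : nat) (S : modular_system p)
    (gT : finGroupType) (G : {group gT}) (chi phi : {ffun gT -> ms_K S}) : nat :=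
  xget 0%N [set d | is_decomposition_number G chi phi d]%classic.

(* Main.v *)
Require Import Defs.
From mathcomp Require Import all_boot all_order all_fingroup all_algebra.
From mathcomp Require Import all_solvable all_character.
From mathcomp Require Import boolp classical_sets fsbigop.

Import GRing.Theory.
Local Open Scope ring_scope.

(** The function [chi^(p)] is a class function, and [K] is a splitting field of
    characteristic [0], so [chi^(p) = \sum_psi a_psi psi] over the ordinary
    irreducible characters ([class_function_expansion]).

    At [p]-regular elements an ordinary character is a sum of Brauer characters
    with the decomposition numbers as coefficients: the eigenvalues of such an
    element on an integral form are roots of unity in [R], and they lift the
    eigenvalues on the composition factors of the reduction
    ([brauer_decomposition]). By hypothesis [chi] and [chi^(p)] agree at the
    [p]-regular elements. Substituting the decomposition of each [psi] gives two
    expressions of the same function as combinations of irreducible Brauer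
    characters, and these are linearly independent over [K]
    ([brauer_characters_independent]); comparing the coefficients of [phi] is
    the claim.

    Independence is proved by clearing denominators in a relation until it is
    integral with one coefficient [1], and reducing it. What remains is a
    relation between the traces of non-isomorphic irreducible modules over [F],
    at first only on [p]-regular elements, but a trace in characteristic [p]
    does not see the [p]-part of an element ([mxtrace_p_regular]). Such a
    relation is trivial, since some element of the group ring kills all but one
    of the modules ([irr_trace_independent]).

    A decomposition number is defined through an integral form, a composition
    series and a module affording [phi], all of them chosen. Integral forms
    exist by an argument with determinants of least valuation
    ([R_form_exists]). The choices need not be compared, because
    [brauer_decomposition] holds for each of them. *)

(** * Characteristic polynomials along composition series *)

Lemma char_poly_block_lower (R : comNzRingType) (a b : nat)
    (A : 'M[R]_a) (C : 'M[R]_(b, a)) (D : 'M[R]_b) :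
  char_poly (block_mx A 0 C D) = char_poly A * char_poly D.
Proof.
rewrite /char_poly -(det_lblock _ (- map_mx polyC C)); congr (\det _).
rewrite /char_poly_mx map_block_mx map_mx0 -[('X)%:M]submxK scalar_mx_block.
by rewrite !block_mxKul !block_mxKur !block_mxKdl !block_mxKdr opp_block_mx
           add_block_mx !sub0r oppr0.
Qed.

Lemma char_poly_conj (R : idomainType) (n : nat) (M A B : 'M[R]_n) :
  M \in unitmx -> M *m A = B *m M -> char_poly A = char_poly B.
Proof.
move=> uM MA; pose Mx := map_mx (@polyC R) M.
have Mx_unit : Mx \in unitmx.
  by rewrite unitmxE det_map_mx rmorph_unit // -unitmxE.
have MxE : Mx *m char_poly_mx A = char_poly_mx B *m Mx.
  by rewrite mulmxBr mulmxBl -!map_mxM MA scalar_mxC.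
apply: (@mulrI _ (\det Mx)); first by rewrite -unitmxE.
by rewrite -!det_mulmx MxE !det_mulmx mulrC.
Qed.

(** The characteristic polynomial is multiplicative on a short exact sequence
    [0 -> A -> B -> C -> 0]: in a basis of the middle term that extends the
    image of the first, the endomorphism is block triangular. *)
Lemma char_poly_exact (F : fieldType) (a b n : nat)
    (i : 'M[F]_(a, n)) (q : 'M[F]_(n, b)) (S : 'M_a) (T : 'M_n) (Q : 'M_b) :
  (a + b)%N = n -> row_free i -> row_full q -> i *m q = 0 ->
  i *m T = S *m i -> T *m q = q *m Q ->
  char_poly T = char_poly S * char_poly Q.
Proof.
move=> def_n; subst n.
move=> /row_freeP[i' ii'].
move=> /row_fullP[q' q'q].
move=> iq0 iT Tq.
pose M := col_mx i q'; pose M' := row_mx ((1%:M - q *m q') *m i') q.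
have MM' : M *m M' = 1%:M.
  rewrite mul_col_row !mulmxA mulmxBr mulmxA iq0 mul0mx mulmx1 subr0 ii' q'q.
  by rewrite mulmxBr mulmx1 mulmxA q'q mul1mx subrr mul0mx -scalar_mx_block.
have uM : M \in unitmx by case: (mulmx1_unit MM').
have M'M : M' *m M = 1%:M by rewrite mulmx1C.
rewrite -(char_poly_block_lower _ _ _ S (q' *m T *m (lsubmx M')) Q).
apply: (char_poly_conj _ _ M) => //.
rewrite mul_block_col mul0mx addr0 mul_col_mx iT; congr col_mx.
rewrite -{1}[q' *m T]mulmx1 -M'M mul_row_col row_mxKl mulmxDr !mulmxA.
by rewrite -[q' *m T *m q]mulmxA Tq !mulmxA q'q mul1mx.
Qed.

Section CharPolySeries.
Context {F : fieldType} {gT : finGroupType} {G : {group gT}}.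

Lemma char_poly_rsim n1 (rG1 : mx_representation F G n1)
    n2 (rG2 : mx_representation F G n2) (g : gT) :
  mx_rsim rG1 rG2 -> g \in G -> char_poly (rG1 g) = char_poly (rG2 g).
Proof.
case=> B def_n; case: _ / def_n in rG2 B * => Bfree homB Gg.
have uB : B \in unitmx by rewrite -row_free_unit.
by symmetry; apply: (char_poly_conj _ _ B); rewrite ?homB.
Qed.

Let in_submodM n (U : 'M[F]_n) a b (A : 'M_(a, b)) (B : 'M_(b, n)) :
  in_submod U (A *m B) = A *m in_submod U B.
Proof. by rewrite in_submodE [in_submod U B]in_submodE mulmxA. Qed.

Let in_factmodM n (U : 'M[F]_n) a b (A : 'M_(a, b)) (B : 'M_(b, n)) :
  in_factmod U (A *m B) = A *m in_factmod U B.
Proof. by rewrite in_factmodE [in_factmod U B]in_factmodE mulmxA. Qed.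

Context {n : nat} (rG : mx_representation F G n).

(** The exact sequence [0 -> U -> W -> W / U -> 0]. *)
Lemma char_poly_section (U W : 'M_n) (modU : mxmodule rG U)
    (modW : mxmodule rG W) (g : gT) : (U <= W)%MS -> g \in G ->
  char_poly (submod_repr modW g)
  = char_poly (submod_repr modU g) * char_poly (section_repr modU modW g).
Proof.
move=> sUW Gg.
pose i := in_submod W (val_submod (1%:M : 'M_(\rank U))).
pose WU := (<<in_factmod U W>>)%MS.
pose q := in_submod WU (in_factmod U (val_submod (1%:M : 'M_(\rank W)))).
have sUW' : (val_submod (1%:M : 'M_(\rank U)) <= W)%MS.
  exact: submx_trans (val_submodP _) sUW.
have sWU : (in_factmod U (val_submod (1%:M : 'M_(\rank W))) <= WU)%MS.
  by rewrite genmxE submxMr // val_submodP.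
apply: (char_poly_exact _ _ _ _ i q).
- by rewrite genmxE addnC mxrank_in_factmod (addsmx_idPr sUW).
- rewrite /row_free /i -(mxrankMfree _ (row_base_free W)).
  by rewrite -[_ *m row_base W]/(val_submod _) in_submodK ?val_submod1.
- rewrite /row_full /q -(mxrankMfree _ (row_base_free WU)).
  rewrite -[_ *m row_base WU]/(val_submod _) in_submodK // genmxE.
  by rewrite eqn_leq !mxrankS ?submxMr ?val_submod1.
- rewrite /q in_submodE mulmxA in_factmodE mulmxA -val_submodE.
  have in0 : in_factmod U (val_submod (1%:M : 'M_(\rank U))) = 0.
    by apply/eqP; rewrite in_factmod_eq0 val_submodP.
  by rewrite /i in_submodK // -in_factmodE in0 mul0mx.
- rewrite /i -in_submodJ // -val_submodJ // mul1mx.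
  by rewrite [in LHS]val_submodE in_submodM.
- rewrite /q /section_repr -in_submodJ // -in_factmodJ // -val_submodJ // mul1mx.
  by rewrite [in RHS]val_submodE [in RHS]in_factmodM [in RHS]in_submodM.
Qed.

(** Hence the eigenvalues of [g] are those on the composition factors, counted
    with multiplicity; unlike the trace this keeps enough information in
    characteristic [p] to be lifted. *)
Lemma char_poly_series (V : seq 'M[F]_n) (compV : mx_composition_series rG V)
    (g : gT) : (last 0 V :=: 1%:M)%MS -> g \in G ->
  char_poly (rG g) = \prod_(i < size V) char_poly (series_repr i compV g).
Proof.
move=> V1 Gg; rewrite /series_repr; have ltV := mx_series_lt compV.
move: (proj1 compV) => modV {compV}.
suffices prefix (modL : mxmodule rG (last 0 V)) :
    char_poly (submod_repr modL g)
    = \prod_(i < size V) char_poly (subseries_repr i modV g).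
  have modL : mxmodule rG (last 0 V) by rewrite (eqmx_module _ V1) mxmodule1.
  by rewrite -(prefix modL) (char_poly_rsim _ _ _ _ _ (rsim_submod1 modL V1)).
elim/last_ind: V {V1} modV ltV modL => [|V W IHV] modV ltV modL.
  rewrite big_ord0 /char_poly; move: (char_poly_mx _).
  by rewrite mxrank0 => A; rewrite det_mx00.
have modV' : mx_subseries rG V.
  by move: modV; rewrite /mx_subseries all_rcons => /andP[].
have modL' : mxmodule rG (last 0 V).
  by rewrite (last_nth 0); apply: mx_subseries_module'.
have /andP[ltV' ltVW] : path ltmx 0 V && (last 0 V < W)%MS.
  by rewrite -rcons_path.
move: modL; rewrite last_rcons => modW.
rewrite (char_poly_section _ _ modL' modW) ?ltmxW //.
rewrite (IHV modV') //.
rewrite -(big_mkord xpredT (fun i => char_poly (subseries_repr i modV' g))).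
rewrite -(big_mkord xpredT (fun i => char_poly (subseries_repr i modV g))).
rewrite size_rcons big_nat_recr ?leq0n //; congr (_ * _).
  apply: eq_big_nat => i /andP[_ lt_i]; apply: char_poly_rsim => //.
  apply: section_eqmx; last by rewrite nth_rcons lt_i.
  by rewrite -rcons_cons nth_rcons /= ltnS ltnW.
apply: char_poly_rsim => //; apply: section_eqmx.
  by rewrite -rcons_cons nth_rcons /= ltnS leqnn -last_nth.
by rewrite nth_rcons ltnn eqxx.
Qed.

End CharPolySeries.

(** * Eigenvalues of a single element *)

Lemma composition_series_exists (F : fieldType) (gT : finGroupType)
    (G : {group gT}) (n : nat) (rG : mx_representation F G n) :
  exists V (compV : mx_composition_series rG V), (last 0 V :=: 1%:M)%MS.
Proof.
set P := exists V, _; apply/(asboolP P).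
have := @mx_Schreier F gT G n rG [::] isT isT; apply.
by case=> V [compV V1 _]; apply/asboolP; exists V, compV.
Qed.

(** A one-dimensional representation is a multiplicative character. Its degree
    is a variable because it is the rank of a section in the application. *)
Lemma linear_reprX (F : fieldType) (gT : finGroupType) (G : {group gT})
    (n : nat) (rG : mx_representation F G n) (g : gT) (k : nat) :
  n = 1%N -> g \in G -> char_poly (rG (g ^+ k)%g) = 'X - (\tr (rG g) ^+ k)%:P.
Proof.
move=> n1; subst n => Gg; rewrite repr_mxX // [rG g]mx11_scalar mxtrace_scalar.
rewrite -[_ ^+ k](rmorphXn (@scalar_mx F 1)) /char_poly det_mx11 !mxE eqxx.
by rewrite !mulr1n.
Qed.

(** Over a splitting field the composition factors of a module for the abelian
    group [<[g]>] are one-dimensional. One list serves for all powers of [g],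
    because the same linear characters give the eigenvalues of each. *)
Lemma cyclic_eigenvalues (F : fieldType) (gT : finGroupType) (G : {group gT})
    (n : nat) (rG : mx_representation F G n) (g : gT) :
  g \in G -> group_splitting_field F <[g]> ->
  exists s : seq F, all (fun z => z ^+ #[g]%g == 1) s /\
    forall k : nat,
      char_poly (rG (g ^+ k)%g) = \prod_(z <- s) ('X - (z ^+ k)%:P).
Proof.
move=> Gg splitg; have sgG : <[g]>%g \subset G by rewrite cycle_subG.
have g_g := cycle_id g; set rg := subg_repr rG sgG.
have [V [compV V1]] := composition_series_exists _ _ _ _ rg.
have linV i : (i < size V)%N -> \rank <<in_factmod (0 :: V)`_i V`_i>>%MS = 1%N.
  move=> lt_i; apply/eqP; rewrite -(abelian_abs_irr (series_repr i compV)).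
    exact/splitg/mx_series_repr_irr.
  exact: cycle_abelian.
pose z i := \tr (series_repr i compV g).
have zX i k : (i < size V)%N ->
    char_poly (series_repr i compV (g ^+ k)%g) = 'X - (z i ^+ k)%:P.
  by move=> lt_i; apply: linear_reprX => //; apply: linV.
exists [seq z i | i <- iota 0 (size V)]; split=> [|k].
  rewrite all_map; apply/allP=> i; rewrite mem_iota add0n /= => lt_i.
  have : 'X - (z i ^+ #[g]%g)%:P = 'X - (z i ^+ 0)%:P :> {poly F}.
    have zX0 := zX i 0 lt_i; rewrite expg0 in zX0.
    have zXm := zX i #[g]%g lt_i; rewrite expg_order in zXm.
    exact: etrans (esym zXm) zX0.
  by move/addrI/oppr_inj/polyC_inj; rewrite expr0 => ->.
rewrite big_map -{1}(subn0 (size V)) -/(index_iota 0 (size V)) big_mkord.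
rewrite -[rG _]/(rg _) (char_poly_series _ _ compV) ?mem_cycle //.
by apply: eq_bigr => i _; rewrite zX.
Qed.

Lemma mxtrace_roots (F : fieldType) (n : nat) (A : 'M[F]_n) (s : seq F) :
  char_poly A = \prod_(z <- s) ('X - z%:P) -> \tr A = \sum_(z <- s) z.
Proof.
move=> charA; have size_s : size s = n.
  by apply/eq_add_S; rewrite -(size_char_poly A) charA size_prod_XsubC.
have [n0 | n_gt0] := posnP n.
  rewrite (size0nil (etrans size_s n0)) big_nil /mxtrace big1 // => -[i lt_i] _.
  by exfalso; rewrite n0 in lt_i.
apply: oppr_inj; rewrite -char_poly_trace // charA -size_s.
by rewrite coefPn_prod_XsubC // size_s -lt0n.
Qed.

Lemma p_regular_constt (p : nat) (gT : finGroupType) (g : gT) :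
  prime p -> p_regular p (g.`_p^')%g.
Proof. by move=> p_pr; rewrite /p_regular -p'natE //; apply: p_elt_constt. Qed.

(** In characteristic [p] a root of unity has order prime to [p], so the
    eigenvalues of [g] are those of its [p]-regular part. Hence the trace of a
    modular representation is determined by its values at the [p]-regular
    elements. *)
Lemma mxtrace_p_regular (p : nat) (F : fieldType) (gT : finGroupType)
    (G : {group gT}) (n : nat) (rG : mx_representation F G n) (g : gT) :
  p \in [pchar F] -> g \in G -> group_splitting_field F <[g]> ->
  \tr (rG g) = \tr (rG (g.`_p^')%g).
Proof.
move=> charFp Gg splitg.
have [s [s1 charX]] := cyclic_eigenvalues _ _ _ _ rG g Gg splitg.
have trX k : \tr (rG (g ^+ k)%g) = \sum_(z <- s) z ^+ k.
  by rewrite (mxtrace_roots _ _ _ [seq z ^+ k | z <- s]) !big_map.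
rewrite trX -{1}(expg1 g) trX; apply: eq_big_seq => z s_z.
(* [k] is the exponent that defines the [p]-regular part of [g]; it is [1]
   modulo the order [m] of that part. *)
rewrite expr1; set m := (#[g]%g`_p^')%N; set k := chinese _ _ _ _.
have zm1 : z ^+ m = 1.
  have qF : ([pchar F]).-nat (#[g]%g`_p)%N.
    by rewrite (eq_pnat _ (pcharf_eq charFp)) part_pnat.
  suffices : (z ^+ m - 1) ^+ (#[g]%g`_p)%N == 0.
    by rewrite expf_eq0 subr_eq0 => /andP[_ /eqP].
  rewrite exprDn_pchar // exprNn_pchar // expr1n -exprM mulnC partnC //.
  by rewrite subr_eq0 (allP s1).
have k1 : k = 1 %[mod m] by apply: chinese_modl; rewrite coprime_partC.
by rewrite -(expr_mod k zm1) k1 expr_mod.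
Qed.

(** * Linear independence of irreducible traces *)

Section IrreducibleTraces.
Context {F : fieldType} {gT : finGroupType} {G : {group gT}}.

Local Notation R_G := (group_ring F G).

(** Schur's lemma for two representations of possibly different degrees. *)
Lemma intertwiner_rsim n1 (rG1 : mx_representation F G n1)
    n2 (rG2 : mx_representation F G n2) (T : 'M[F]_(n1, n2)) :
  mx_irreducible rG1 -> mx_irreducible rG2 ->
  (forall g, g \in G -> rG1 g *m T = T *m rG2 g) -> T != 0 ->
  mx_rsim rG1 rG2.
Proof.
move=> /mx_irrP[_ irr1] /mx_irrP[_ irr2] homT nzT.
have Tfree : row_free T.
  rewrite -kermx_eq0; apply: contraNT nzT => /irr1 ker_full.
  have /row_fullP[B BK] : row_full (kermx T).
    apply/ker_full/mxmoduleP => g Gg; apply/sub_kermxP.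
    by rewrite -mulmxA homT // mulmxA mulmx_ker mul0mx.
  by rewrite -[T]mul1mx -BK -mulmxA mulmx_ker mulmx0.
have Tfull : row_full T.
  rewrite /row_full -genmxE; apply: irr2; last by rewrite (eqmx_eq0 (genmxE _)).
  rewrite (eqmx_module _ (genmxE _)); apply/mxmoduleP => g Gg.
  by rewrite -homT // submxMl.
by exists T => //; rewrite -(eqP Tfree) (eqP Tfull).
Qed.

(** Burnside's theorem, in the form used to prescribe operators. *)
Lemma gring_op_onto n (rG : mx_representation F G n) (X : 'M[F]_n) :
  mx_absolutely_irreducible rG -> exists2 A, (A \in R_G)%MS & gring_op rG A = X.
Proof.
case/andP=> _ E_full.
exists (gring_mx (regular_repr F G)
          (mxvec X *m pinvmx (enveloping_algebra_mx rG))).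
  exact: gring_mxP.
rewrite gring_op_mx /gring_mx /= mulmxKpV ?mxvecK //.
by rewrite submx_full.
Qed.

(** If everything that kills [M] also kills [L], then [L] is a module over the
    image of the group ring in [End M], which is a full matrix ring. As a
    module over itself that ring is a sum of copies of [M], so a sum of copies
    of [M] maps onto [L], and [L] is isomorphic to [M]. *)
Lemma irr_separate m (M : mx_representation F G m)
    n (L : mx_representation F G n) :
  mx_absolutely_irreducible M -> mx_absolutely_irreducible L ->
  ~ mx_rsim M L ->
  exists A, [/\ (A \in R_G)%MS, gring_op M A = 0 & gring_op L A != 0].
Proof.
move=> absM absL notML; apply: contrapT => noA; apply: notML.
have kill A : (A \in R_G)%MS -> gring_op M A = 0 -> gring_op L A = 0.
  by move=> RA MA; apply: contrapT => /eqP LA; apply: noA; exists A.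
have [n_gt0 _] := andP absL.
pose phi : {linear 'M[F]_m -> 'M[F]_n} :=
  gring_mx L \o mulmxr (pinvmx (enveloping_algebra_mx M)) \o mxvec.
(* The map [End M -> End L] that [kill] yields: lift an operator to the group
   ring and let the lift act on [L]. *)
have phi_op A : (A \in R_G)%MS -> phi (gring_op M A) = gring_op L A.
  move=> RA; rewrite /phi /= -gring_op_mx; set a := _ *m pinvmx _.
  apply/eqP; rewrite -subr_eq0 -linearB; apply/eqP/kill.
    by rewrite linearB /= addmx_sub ?eqmx_opp ?RA //; exact: gring_mxP.
  rewrite linearB /= gring_op_mx /gring_mx /= /a mulmxKpV ?mxvecK ?subrr //.
  by rewrite submx_full //; case/andP: absM.
clearbody phi; have phiM B g : g \in G -> phi (B *m M g) = phi B *m L g.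
  move=> Gg; have [A RA <-] := gring_op_onto _ M B absM.
  rewrite -(gring_opG M Gg) -gring_opM ?envelop_mx_id // phi_op ?phi_op //.
    by rewrite gring_opM ?envelop_mx_id // gring_opG.
  by rewrite envelop_mxM ?envelop_mx_id.
(* The matrices supported on row [r] form a copy of [M] inside [End M]; follow
   its inclusion by [phi] and by the projection to row [k], a copy of [L]. *)
pose T r k : 'M[F]_(m, n) := \matrix_(i, j) phi (delta_mx r i) k j.
have homT r k g : g \in G -> M g *m T r k = T r k *m L g.
  move=> Gg; apply/matrixP=> i j.
  transitivity (phi (delta_mx r i *m M g) k j); last first.
    by rewrite phiM // !mxE; apply: eq_bigr => l _; rewrite mxE.
  have -> : delta_mx r i *m M g = \sum_l M g i l *: delta_mx r l.
    apply/matrixP=> u v; rewrite summxE mxE (bigD1 i) //= big1 => [|l ne_li].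
      rewrite mxE eqxx andbT (bigD1 v) //= big1 => [|l ne_lv].
        by rewrite !mxE eqxx andbT !addr0 mulrC.
      by rewrite !mxE [v == l]eq_sym (negPf ne_lv) andbF mulr0.
    by rewrite mxE (negPf ne_li) andbF mul0r.
  rewrite linear_sum summxE mxE; apply: eq_bigr => l _.
  by rewrite linearZ !mxE.
have [[r [k nzT]]|T0] := pselect (exists r k, T r k != 0).
  apply: (intertwiner_rsim _ _ _ _ (T r k)) => //; first exact: mx_abs_irrW.
    exact: mx_abs_irrW.
  exact: homT.
have phi0 B : phi B = 0.
  rewrite [B]matrix_sum_delta !linear_sum big1 // => r _.
  rewrite linear_sum big1 // => i _; rewrite linearZ /=.
  suffices -> : phi (delta_mx r i) = 0 by rewrite scaler0.
  apply/matrixP=> k j; rewrite mxE; apply: contrapT => /eqP nz; apply: T0.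
  by exists r, k; apply: contra nz => /eqP/matrixP/(_ i j); rewrite !mxE => ->.
have := phi_op 1%:M (envelop_mx1 _); rewrite phi0 gring_op1 => /esym/matrixP.
by move=> /(_ (Ordinal n_gt0) (Ordinal n_gt0))/eqP; rewrite !mxE eqxx oner_eq0.
Qed.

Lemma mulmx_entries n (C D : 'M[F]_n) (j k : 'I_n) (i l : 'I_n) :
  (C *m delta_mx j k *m D) i l = C i j * D k l.
Proof.
rewrite mxE (bigD1 k) //= mxE (bigD1 j) //= mxE !eqxx mulr1.
rewrite big1 => [|j' /negPf ne]; last by rewrite mxE ne mulr0.
rewrite addr0 big1 ?addr0 // => k' /negPf ne.
by rewrite mxE big1 ?mul0r // => j' _; rewrite mxE ne andbF mulr0.
Qed.

(** The annihilator of [L] is a prime ideal of the group ring: if [A] and [B]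
    do not kill [L] then neither does [A X B] for a suitable [X]. So the
    elements that separate [L] from each of the modules can be multiplied. *)
Lemma irr_separate_all (I : eqType) (s : seq I) (m : I -> nat)
    (M : forall i, mx_representation F G (m i))
    n (L : mx_representation F G n) :
  (forall i, mx_absolutely_irreducible (M i)) -> mx_absolutely_irreducible L ->
  (forall i, i \in s -> ~ mx_rsim (M i) L) ->
  exists A, [/\ (A \in R_G)%MS, forall i, i \in s -> gring_op (M i) A = 0
              & gring_op L A != 0].
Proof.
move=> absM absL; elim: s => [|i s IHs] notL.
  exists 1%:M; split; rewrite ?envelop_mx1 // gring_op1 -mxrank_eq0 mxrank1.
  by rewrite -lt0n; case/andP: absL.
have [|A [RA MA LA]] := IHs.
  by move=> j sj; apply: notL; rewrite inE sj orbT.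
have [B [RB MB LB]] :=
  irr_separate _ _ _ _ (absM i) absL (notL i (mem_head i s)).
have /matrix0Pn[a [b nzA]] := LA; have /matrix0Pn[c [d nzB]] := LB.
have [X RX LX] := gring_op_onto _ L (delta_mx b c) absL.
exists (A *m X *m B); split.
- by rewrite !envelop_mxM.
- move=> j; rewrite inE => /predU1P[-> | sj].
    by rewrite gring_opM // MB mulmx0.
  by rewrite !gring_opM // MA // !mul0mx.
apply/matrix0Pn; exists a, d; rewrite !gring_opM // LX mulmx_entries.
by rewrite mulf_neq0.
Qed.

(** Apply the relation to [A X], where [A] kills all the modules but one and
    [X] is chosen so that [A X] has nonzero trace on that one. *)
Lemma irr_trace_independent (I : finType) (P : pred I) (m : I -> nat)
    (M : forall i, mx_representation F G (m i)) (c : I -> F) :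
  (forall i, mx_absolutely_irreducible (M i)) ->
  {in P &, forall i j, mx_rsim (M i) (M j) -> i = j} ->
  (forall g, g \in G -> \sum_(i | P i) c i * \tr (M i g) = 0) ->
  forall i, P i -> c i = 0.
Proof.
move=> absM neqM sum0 i Pi.
have sum0A A : (A \in R_G)%MS ->
    \sum_(j | P j) c j * \tr (gring_op (M j) A) = 0.
  case/envelop_mxP=> a ->.
  transitivity (\sum_(g in G) a g * \sum_(j | P j) c j * \tr (M j g)).
    under [RHS]eq_bigr do rewrite mulr_sumr.
    rewrite [RHS]exchange_big /=.
    apply: eq_bigr => j _; rewrite !linear_sum /= mulr_sumr.
    apply: eq_bigr => g Gg.
    by rewrite !linearZ /= gring_opG // mulrCA.
  by rewrite big1 // => g Gg; rewrite sum0 // mulr0.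
have [|A [RA MA LA]] :=
    irr_separate_all I [seq j <- enum I | P j && (j != i)] _ M
      _ (M i) absM (absM i).
  move=> j; rewrite mem_filter => /andP[/andP[Pj /eqP neq] _] /neqM eqji.
  by apply: neq; apply: eqji.
have /matrix0Pn[a [b nzA]] := LA.
have [X RX LX] := gring_op_onto _ (M i) (delta_mx b a) (absM i).
have := sum0A (A *m X); rewrite envelop_mxM // => /(_ isT).
rewrite (bigD1 i) //= big1 => [|j /andP[Pj ne]]; last first.
  rewrite gring_opM // MA; first by rewrite mul0mx linear0 mulr0.
  by rewrite mem_filter Pj ne mem_enum.
rewrite addr0 gring_opM // LX => /eqP; rewrite mulf_eq0 => /orP[/eqP // | ].
move: (gring_op (M i) A) nzA => C nzC.
suffices -> : \tr (C *m delta_mx b a) = C a b by rewrite (negPf nzC).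
rewrite /mxtrace (bigD1 a) //= big1 => [|k /negPf ne]; rewrite mxE.
  rewrite addr0 (bigD1 b) //= mxE !eqxx mulr1 big1 ?addr0 // => k /negPf ne.
  by rewrite mxE ne mulr0.
by rewrite big1 // => l _; rewrite mxE ne andbF mulr0.
Qed.

End IrreducibleTraces.

(** * Integrality in the fraction field *)

Section Integrality.
Context {p : nat} (S : modular_system p).
Local Notation R := (ms_R S).
Local Notation K := (ms_K S).
Local Notation F := (ms_F S).
Local Notation emb := (ms_emb S).
Local Notation red := (ms_red S).

(** For [y != 0] this says that the valuation of [x] is at least that of [y]. *)
Definition integral_multiple (x y : K) : Prop := exists r : R, x = emb r * y.

Lemma emb_eq0 (r : R) : (emb r == 0) = (r == 0).
Proof. by rewrite -(inj_eq (@ms_emb_inj _ S)) rmorph0. Qed.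

Lemma integral_multiple_trans (x y z : K) :
  integral_multiple x y -> integral_multiple y z -> integral_multiple x z.
Proof. by move=> [r ->] [s ->]; exists (r * s); rewrite rmorphM mulrA. Qed.

(** The valuation orders the fraction field: of two elements one is a multiple
    of the other by a ring element. *)
Lemma integral_multiple_total (x y : K) :
  integral_multiple x y \/ integral_multiple y x.
Proof.
have [t [[t_neq0 _ unif] _]] := ms_complete_dvr S.
have [-> | x_neq0] := eqVneq x 0.
  by left; exists 0; rewrite rmorph0 mul0r.
have [-> | y_neq0] := eqVneq y 0.
  by right; exists 0; rewrite rmorph0 mul0r.
have [a [b [b_neq0 xy]]] := ms_emb_frac (x / y).
have a_neq0 : a != 0.
  apply: contraNneq (mulf_neq0 x_neq0 (invr_neq0 y_neq0)) => a0.
  by rewrite xy a0 rmorph0 mul0r.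
have {xy} xb : emb b * x = emb a * y.
  apply: (mulIf (invr_neq0 y_neq0)); rewrite -mulrA xy mulfK //.
  by rewrite mulrCA mulfV ?mulr1 // emb_eq0.
have divide (c d : R) (u v : K) : d != 0 -> emb d * u = emb (c * d) * v ->
    integral_multiple u v.
  move=> d_neq0 uv; exists c.
  apply: (@mulfI _ (emb d)); first by rewrite emb_eq0.
  by rewrite uv rmorphM mulrCA mulrA.
have [n [u [u_unit a_eq]]] := unif a a_neq0.
have [m [v [v_unit b_eq]]] := unif b b_neq0.
have [le_mn | /ltnW le_nm] := leqP m n; [left | right].
  apply: (divide (u * v^-1 * t ^+ (n - m)) b) => //; rewrite xb a_eq b_eq.
  by rewrite mulrACA mulrVK // -exprD subnK.
apply: (divide (v * u^-1 * t ^+ (m - n)) a) => //; rewrite -xb a_eq b_eq.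
by rewrite mulrACA mulrVK // -exprD subnK.
Qed.

Lemma max_valuation (I : finType) (x : I -> K) (i0 : I) : x i0 != 0 ->
  exists2 j, x j != 0 & forall i, integral_multiple (x i) (x j).
Proof.
move=> nz_i0.
suffices [j max_j] : exists j,
    forall i, i \in enum I -> integral_multiple (x i) (x j).
  exists j => [|i]; last by apply: max_j; rewrite mem_enum.
  have [|r x_i0] := max_j i0; first by rewrite mem_enum.
  by apply: contraNneq nz_i0 => x_j; rewrite x_i0 x_j mulr0.
elim: (enum I) => [|i s [j max_j]]; first by exists i0.
have [ij | ji] := integral_multiple_total (x i) (x j).
  by exists j => k; rewrite inE => /predU1P[-> | /max_j].
exists i => k; rewrite inE => /predU1P[-> | /max_j kj].
  by exists 1; rewrite rmorph1 mul1r.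
exact: integral_multiple_trans kj ji.
Qed.

(** One of [z] and [z^-1] is integral, and each is a power of the other. *)
Lemma root_of_unity_integral (m : nat) (z : K) : (0 < m)%N -> z ^+ m = 1 ->
  exists2 r : R, r ^+ m = 1 & z = emb r.
Proof.
move=> m_gt0 zm1; have emb1 r : emb r ^+ m = 1 -> r ^+ m = 1.
  by rewrite -rmorphXn -(rmorph1 emb) => /ms_emb_inj.
have [[r z_r] | [r r_z]] := integral_multiple_total z 1.
  by exists r; rewrite z_r mulr1 in zm1 *; rewrite ?emb1.
have rm1 : r ^+ m = 1.
  apply: emb1; have := congr1 (fun y => y ^+ m) r_z.
  by rewrite exprMn zm1 expr1n mulr1 => <-.
exists (r ^+ m.-1); first by rewrite exprAC rm1 expr1n.
have: emb (r ^+ m.-1) * (emb r * z) = z.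
  by rewrite mulrA -rmorphM -exprSr prednK // rm1 rmorph1 mul1r.
by rewrite -r_z mulr1.
Qed.

(** If [p] does not divide [m] then the polynomial [X ^ m - 1] is separable
    over the residue field, so that [m]-th roots of unity stay distinct under
    reduction. *)
Lemma root_of_unity_red_inj (m : nat) (x y : R) : ~~ (p %| m)%N ->
  x ^+ m = 1 -> y ^+ m = 1 -> red x = red y -> x = y.
Proof.
move=> p'm xm1 ym1 xy.
have m_gt0 : (0 < m)%N by case: m p'm {xm1 ym1}; rewrite ?dvdn0.
have : x ^+ m - y ^+ m = 0 by rewrite xm1 ym1 subrr.
(* The second factor of [x ^+ m - y ^+ m] reduces to [m * red x ^+ m.-1]. *)
rewrite subrXX => /eqP; rewrite mulf_eq0 subr_eq0 => /orP[/eqP // | sum0].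
have : red (\sum_(i < m) x ^+ (m.-1 - i) * y ^+ i) = red 0.
  by rewrite (eqP sum0).
rewrite rmorph0 rmorph_sum /= (eq_bigr (fun=> red x ^+ m.-1)); last first.
  move=> i _.
  by rewrite rmorphM !rmorphXn -xy -exprD subnK // -ltnS prednK.
rewrite sumr_const card_ord -mulr_natl => /eqP; rewrite mulf_eq0.
rewrite -(dvdn_pcharf (ms_F_charp S)) (negPf p'm) /= => /eqP x0.
have := congr1 red xm1; rewrite -(prednK m_gt0) exprS rmorphM rmorphXn x0 mulr0.
by rewrite rmorph1 => /esym/eqP; rewrite oner_eq0.
Qed.

End Integrality.

(** * Integral forms *)

Section IntegralForms.
Context {p : nat} (S : modular_system p).
Context {gT : finGroupType} {G : {group gT}}.
Local Notation R := (ms_R S).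
Local Notation K := (ms_K S).
Local Notation emb := (ms_emb S).

(** Cramer's rule: coordinate [k] of a row vector in a basis [B] is the ratio by
    which the determinant changes when the vector replaces row [k]. *)
Lemma det_replace_row (n : nat) (B B' : 'M[K]_n) (k : 'I_n) :
  B \in unitmx -> (forall l, l != k -> row l B' = row l B) ->
  \det B' = (row k B' *m invmx B) 0 k * \det B.
Proof.
move=> uB eqB; rewrite (expand_det_row B' k) /invmx uB -scalemxAr mxE mxE.
rewrite mulrC mulrA mulrV ?mul1r -?unitmxE //; apply: eq_bigr => l _.
rewrite !mxE; congr (_ * _); rewrite /cofactor; congr (_ * \det _).
apply/matrixP=> i j; rewrite !mxE.
have ne : lift k i != k by rewrite eq_sym neq_lift.
by have /rowP/(_ (lift l j)) := eqB _ ne; rewrite !mxE.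
Qed.

(** Among the bases of [K ^ n] made of vectors [e_i g], one whose determinant
    has least valuation spans over [R] the lattice generated by all the
    vectors [e_i g]: by Cramer's rule the coordinates of such a vector are
    quotients of determinants of the same kind by the least one. Since [G]
    permutes the vectors [e_i g], it acts on that lattice. *)
Lemma R_form_exists (n : nat) (rG : mx_representation K G n) :
  exists rU : mx_representation R G n, R_form_of (character_of rG) rU.
Proof.
pose e (x : 'I_n * gT) : 'rV[K]_n := row x.1 (rG x.2).
pose I := {f : {ffun 'I_n -> 'I_n * gT} | [forall k, (f k).2 \in G]}.
pose B (f : {ffun 'I_n -> 'I_n * gT}) := \matrix_k e (f k).
have BG f k : [forall k, (f k).2 \in G] -> (f k).2 \in G by move/forallP.
(* The standard basis shows that some of the determinants are not zero. *)
pose f1 : {ffun 'I_n -> 'I_n * gT} := [ffun k => (k, 1%g)].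
have f1G : [forall k, (f1 k).2 \in G].
  by apply/forallP=> k; rewrite ffunE group1.
have B1 : B f1 = 1%:M.
  by apply/row_matrixP=> k; rewrite rowK ffunE /e /= repr_mx1.
have [|[f fG] /= f_neq0 f_min] :=
    max_valuation S I (fun f => \det (B (val f))) (Sub f1 f1G).
  by rewrite /= B1 det1 oner_eq0.
have uB : B f \in unitmx by rewrite unitmxE unitfE.
have coord x k : x.2 \in G -> exists r, (e x *m invmx (B f)) 0 k = emb r.
  move=> x2G.
  pose f' : {ffun 'I_n -> 'I_n * gT} := [ffun l => if l == k then x else f l].
  have f'G : [forall l, (f' l).2 \in G].
    by apply/forallP=> l; rewrite ffunE; case: ifP => // _; apply: BG.
  have [r /= det_r] := f_min (Sub f' f'G); exists r; apply: (mulIf f_neq0).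
  rewrite -det_r (det_replace_row _ (B f) (B f') k) // => [|l /negPf ne].
    by rewrite rowK ffunE eqxx.
  by rewrite !rowK ffunE ne.
have /choice[Y YE] g : exists Y : 'M[R]_n,
    g \in G -> map_mx emb Y = B f *m rG g *m invmx (B f).
  have [Gg | _] := boolP (g \in G); last by exists 0.
  have /choice[y yE] (ij : 'I_n * 'I_n) :
      exists r, (B f *m rG g *m invmx (B f)) ij.1 ij.2 = emb r.
    case: ij => i j /=.
    have [|r r_E] := coord ((f i).1, ((f i).2 * g)%g) j.
      by rewrite groupM ?BG.
    exists r; rewrite -r_E.
    suffices -> : e ((f i).1, ((f i).2 * g)%g) = row i (B f *m rG g).
      by rewrite -row_mul [RHS]mxE.
    by rewrite row_mul rowK /e /= repr_mxM ?BG // row_mul.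
  exists (\matrix_(i, j) y (i, j)) => _; apply/matrixP=> i j.
  by rewrite [LHS]mxE [X in emb X]mxE -yE.
have emb_mx_inj (A C : 'M[R]_n) : map_mx emb A = map_mx emb C -> A = C.
  move=> /matrixP AC; apply/matrixP=> i j; apply: (@ms_emb_inj _ S).
  by have := AC i j; rewrite !mxE.
have Y_repr : mx_repr G Y.
  split=> [|g h Gg Gh]; apply: emb_mx_inj.
    by rewrite YE // repr_mx1 mulmx1 mulmxV // map_mx1.
  rewrite map_mxM !YE ?groupM // repr_mxM // !mulmxA. by rewrite mulmxKV.
exists (MxRepresentation Y_repr); apply/ffunP=> g; rewrite !ffunE.
case: ifP => // Gg; transitivity (\tr (map_mx emb (Y g))); first by [].
rewrite YE //.
rewrite mxtrace_mulC mulmxA mulVmx //.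
by rewrite mul1mx.
Qed.

End IntegralForms.

(** * Brauer characters *)

Section BrauerCharacters.
Context {p : nat} (S : modular_system p).
Local Notation R := (ms_R S).
Local Notation K := (ms_K S).
Local Notation F := (ms_F S).
Local Notation emb := (ms_emb S).
Local Notation red := (ms_red S).

(** For [A] the action of an element of order [m] prime to [p], [v] is the value
    of the Brauer character there. *)
Definition lifted_trace (n : nat) (A : 'M[F]_n) (m : nat) (v : K) : Prop :=
  exists s : seq R,
    [/\ all (fun z => z ^+ m == 1) s,
        char_poly A = \prod_(z <- s) ('X - (red z)%:P) &
        v = \sum_(z <- s) emb z].

Lemma perm_eq_red (m : nat) (s t : seq R) : ~~ (p %| m)%N ->
  all (fun z => z ^+ m == 1) s -> all (fun z => z ^+ m == 1) t ->
  perm_eq (map red s) (map red t) -> perm_eq s t.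
Proof.
move=> p'm s1 t1.
(* A left inverse of the reduction on the roots of unity in play. *)
pose lift x := nth 0 (s ++ t) (index x (map red (s ++ t))).
have liftK z : z \in s ++ t -> lift (red z) = z.
  move=> st_z.
  have st1 : all (fun z => z ^+ m == 1) (s ++ t) by rewrite all_cat s1.
  have st_rz : red z \in map red (s ++ t) by apply: map_f.
  have lt_z : (index (red z) (map red (s ++ t)) < size (s ++ t))%N.
    by rewrite -(size_map red) index_mem.
  apply: (root_of_unity_red_inj S m) => //.
  - by apply/eqP/(allP st1)/mem_nth.
  - exact/eqP/(allP st1).
  - by rewrite /lift -(nth_map _ 0) // nth_index.
move/(perm_map lift); rewrite -!map_comp !map_id_in // => z z_in /=.
  by rewrite liftK // mem_cat z_in orbT.
by rewrite liftK // mem_cat z_in.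
Qed.

Lemma lifted_trace_unique (n : nat) (A : 'M[F]_n) (m : nat) (v w : K) :
  ~~ (p %| m)%N -> lifted_trace n A m v -> lifted_trace n A m w -> v = w.
Proof.
move=> p'm [s [s1 As ->]] [t [t1 At ->]]; apply: perm_big.
apply: (perm_eq_red m) => //; apply: prod_XsubC_eq.
by rewrite !big_map -As -At.
Qed.

Context {gT : finGroupType} {G : {group gT}}.

Lemma lifted_trace_rsim n1 (rG1 : mx_representation F G n1)
    n2 (rG2 : mx_representation F G n2) (g : gT) (m : nat) (v : K) :
  mx_rsim rG1 rG2 -> g \in G ->
  lifted_trace n1 (rG1 g) m v -> lifted_trace n2 (rG2 g) m v.
Proof.
by move=> sim12 Gg; rewrite /lifted_trace (char_poly_rsim _ _ _ _ _ sim12).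
Qed.

(** The eigenvalues of [g] on the module over the fraction field are roots of
    unity, hence integral: they lift those of the reduction. *)
Lemma lifted_trace_reduction (n : nat) (rU : mx_representation R G n) (g : gT) :
  g \in G -> group_splitting_field K <[g]> ->
  lifted_trace n (map_mx red (rU g)) #[g]%g (\tr (map_mx emb (rU g))).
Proof.
move=> Gg splitg.
have [s [s1 charX]] := cyclic_eigenvalues _ _ _ _ (map_repr emb rU) g Gg splitg.
have [t ts t1] : exists2 t, map emb t = s & all (fun z => z ^+ #[g]%g == 1) t.
  elim: s s1 {charX} => [|z s IHs] /=; first by exists [::].
  case/andP=> /eqP z1 /IHs[t ts t1].
  have [r r1 z_r] := root_of_unity_integral S _ z (order_gt0 g) z1.
  by exists (r :: t) => /=; rewrite ?ts ?z_r ?r1 ?eqxx.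
have charK : char_poly (map_mx emb (rU g)) = \prod_(z <- s) ('X - z%:P).
  have := charX 1%N; rewrite expg1 => ->.
  by apply: eq_bigr => z _; rewrite expr1.
exists t; split=> //; last by rewrite (mxtrace_roots _ _ _ _ charK) -ts big_map.
have charR : char_poly (rU g) = \prod_(z <- t) ('X - z%:P).
  apply: (map_inj_poly (@ms_emb_inj _ S)); first exact: rmorph0.
  by rewrite map_char_poly charK map_prod_XsubC -ts big_map.
by rewrite -map_char_poly charR map_prod_XsubC.
Qed.

Section Series.
Context {n : nat} {rW : mx_representation F G n} {V : seq 'M[F]_n}.
Context (compV : mx_composition_series rW V) (V1 : (last 0 V :=: 1%:M)%MS).

Lemma lifted_trace_series (g : gT) (m : nat) (v : K) (w : 'I_(size V) -> K) :
  ~~ (p %| m)%N -> g \in G -> lifted_trace n (rW g) m v ->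
  (forall i : 'I_(size V), lifted_trace _ (series_repr i compV g) m (w i)) ->
  v = \sum_i w i.
Proof.
move=> p'm Gg lift_v /choice[s s_w].
apply: (lifted_trace_unique n (rW g) m) => //.
exists (flatten [seq s i | i <- enum 'I_(size V)]); split.
- apply/allP=> z /flattenP[_ /mapP[i _ ->]] s_z.
  by have [/allP/(_ z s_z)] := s_w i.
- rewrite (char_poly_series _ _ compV) // big_flatten big_map big_enum /=.
  by apply: eq_bigr => i _; have [] := s_w i.
- rewrite big_flatten big_map big_enum /=.
  by apply: eq_bigr => i _; have [] := s_w i.
Qed.

Lemma lifted_trace_factor (g : gT) (m : nat) (v : K) (i : 'I_(size V)) :
  g \in G -> lifted_trace n (rW g) m v ->
  exists w, lifted_trace _ (series_repr i compV g) m w.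
Proof.
move=> Gg [s [s1 charW _]].
have : char_poly (series_repr i compV g) %| \prod_(z <- s) ('X - (red z)%:P).
  by rewrite -charW (char_poly_series _ _ compV) // (bigD1 i) //= dvdp_mulr.
case/dvdp_prod_XsubC=> b; rewrite eqp_monic ?char_poly_monic ?monic_prod_XsubC //.
move=> /eqP char_i; exists (\sum_(z <- mask b s) emb z), (mask b s); split=> //.
by apply/allP=> z /mem_mask; apply: (allP s1).
Qed.

End Series.

End BrauerCharacters.

(** * Linear independence of Brauer characters *)

Section BrauerIndependence.
Context {p : nat} (S : modular_system p).
Context {gT : finGroupType} {G : {group gT}}.
Hypothesis S_splitting : splitting_for S G.
Local Notation R := (ms_R S).
Local Notation K := (ms_K S).
Local Notation F := (ms_F S).
Local Notation emb := (ms_emb S).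
Local Notation red := (ms_red S).

Lemma splitting_cycle (g : gT) : g \in G ->
  group_splitting_field K <[g]> /\ group_splitting_field F <[g]>.
Proof. by move=> Gg; apply: S_splitting; rewrite cycle_subG. Qed.

Lemma irr_abs_irr (n : nat) (rL : mx_representation F G n) :
  mx_irreducible rL -> mx_absolutely_irreducible rL.
Proof. by move=> irrL; have [_] := S_splitting G (subxx G); apply. Qed.

Lemma brauer_characterP (n : nat) (rG : mx_representation F G n)
    (beta : {ffun gT -> K}) (g : gT) :
  has_brauer_character rG beta -> g \in G -> p_regular p g ->
  lifted_trace S n (rG g) #[g]%g (beta g).
Proof. by case=> lift _; apply: lift. Qed.

(** Every irreducible module is a composition factor of the regular module,
    which has an integral form, so the eigenvalues of its [p]-regular elements
    lift to roots of unity. *)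
Lemma brauer_character_exists (n : nat) (rL : mx_representation F G n) :
  mx_irreducible rL -> exists beta, has_brauer_character rL beta.
Proof.
move=> irrL.
have [V [compV V1]] := composition_series_exists _ _ _ _ (regular_repr F G).
have [i simLV] := rsim_regular_series irrL compV V1.
have /choice[b bE] g :
    exists v : K, g \in G -> lifted_trace S n (rL g) #[g]%g v.
  have [Gg | _] := boolP (g \in G); last by exists 0.
  have [splitg _] := splitting_cycle g Gg.
  have := lifted_trace_reduction S _ (regular_repr R G) g Gg splitg.
  rewrite map_regular_mx => lift_reg.
  have [v v_i] := lifted_trace_factor S compV V1 g _ _ i Gg lift_reg.
  by exists v => _; apply: lifted_trace_rsim v_i => //; apply: mx_rsim_sym.
exists [ffun g => if (g \in G) && p_regular p g then b g else 0].
split=> [g Gg reg_g | g /negPf not_g]; rewrite ffunE; last by rewrite not_g.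
by rewrite Gg reg_g; apply: bE.
Qed.

(** Scale a relation so that its coefficients are integral and one of them is
    [1]. Its reduction is a nontrivial relation between the traces of the
    irreducible modules on the [p]-regular elements, hence on the whole
    group. *)
Lemma brauer_characters_independent (I : finType) (P : pred I) (m : I -> nat)
    (M : forall i, mx_representation F G (m i)) (beta : I -> {ffun gT -> K})
    (c : I -> K) :
  (forall i, mx_irreducible (M i)) ->
  (forall i, has_brauer_character (M i) (beta i)) ->
  {in P &, forall i j, mx_rsim (M i) (M j) -> i = j} ->
  (forall g, g \in G -> p_regular p g -> \sum_(i | P i) c i * beta i g = 0) ->
  forall i, P i -> c i = 0.
Proof.
move=> irrM brauerM neqM sum0 i Pi; apply: contrapT => /eqP nz_i.
pose c' i := if P i then c i else 0.
have [|j nz_j max_j] := max_valuation S I c' i; first by rewrite /c' Pi.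
have /choice[r rE] := max_j.
have Pj : P j by move: nz_j; rewrite /c'; case: (P j); rewrite ?eqxx.
have charFp := ms_F_charp S.
have red0 g : g \in G -> p_regular p g ->
    \sum_(k | P k) red (r k) * \tr (M k g) = 0.
  move=> Gg reg_g.
  have /choice[b bE] k : exists b : R, emb b = beta k g /\ red b = \tr (M k g).
    have [s [_ char_k beta_k]] := brauer_characterP _ _ _ g (brauerM k) Gg reg_g.
    exists (\sum_(z <- s) z); rewrite !rmorph_sum beta_k; split=> //.
    by rewrite (mxtrace_roots _ _ _ (map red s)) big_map.
  rewrite (eq_bigr (fun k => red (r k * b k))) => [|k _]; last first.
    by rewrite rmorphM; have [_ ->] := bE k.
  rewrite -rmorph_sum; apply/eqP; suffices -> : \sum_(k | P k) r k * b k = 0.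
    by rewrite rmorph0.
  apply/eqP; rewrite -(emb_eq0 S) rmorph_sum; apply/eqP; apply: (mulfI nz_j).
  rewrite mulr0 mulr_sumr -[RHS](sum0 g Gg reg_g); apply: eq_bigr => k Pk.
  rewrite rmorphM mulrCA mulrA; have [-> _] := bE k.
  by rewrite -rE /c' Pk.
have := irr_trace_independent I P m M (fun k => red (r k)) _ neqM _ j Pj.
have r_j : r j = 1.
  apply: (@ms_emb_inj _ S); rewrite rmorph1; apply: (mulIf nz_j).
  by rewrite -rE mul1r.
rewrite r_j rmorph1; move/(_ (fun k => irr_abs_irr _ _ (irrM k))).
move=> indep; suffices /eqP : (1 : F) = 0 by rewrite oner_eq0.
apply: indep => g Gg; have [_ splitg] := splitting_cycle g Gg.
rewrite (eq_bigr (fun k => red (r k) * \tr (M k (g.`_p^')%g))) => [|k _].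
  by apply: red0; rewrite ?groupX ?p_regular_constt ?(pcharf_prime charFp).
by rewrite -mxtrace_p_regular.
Qed.

(** Two non-isomorphic irreducible modules with the same Brauer character would
    satisfy a relation with coefficients [1] and [-1]. *)
Lemma brauer_character_inj n1 (rL1 : mx_representation F G n1)
    n2 (rL2 : mx_representation F G n2) (beta : {ffun gT -> K}) :
  mx_irreducible rL1 -> mx_irreducible rL2 ->
  has_brauer_character rL1 beta -> has_brauer_character rL2 beta ->
  mx_rsim rL1 rL2.
Proof.
move=> irr1 irr2 beta1 beta2; apply: contrapT => neq12.
pose m b := if b then n1 else n2.
pose M b : mx_representation F G (m b) :=
  if b return mx_representation F G (m b) then rL1 else rL2.
suffices : (1 : K) = 0 by move/eqP; rewrite oner_eq0.
apply: (brauer_characters_independent _ xpredT m M (fun=> beta)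
  (fun b : bool => (-1) ^+ b) _ _ _ _ false isT).
- by case.
- by case.
- by case=> [] [] //= _ _ sim; case: neq12 => //; apply: mx_rsim_sym.
- by move=> g _ _; rewrite big_bool /= mulN1r mul1r addNr.
Qed.

End BrauerIndependence.

(** * Expansion of class functions in irreducible characters *)

Section OrdinaryCharacters.
Context {K : fieldType} {gT : finGroupType} {G : {group gT}}.
Hypothesis K_char0 : [pchar K] =i pred0.
Hypothesis K_splitting : group_splitting_field K G.

Local Notation R_G := (group_ring K G).
Local Notation aG := (regular_repr K G).

Lemma char0_pgroup : ([pchar K]^'.-group G)%g.
Proof. by apply/pgroupP=> q _ _; rewrite inE /= K_char0. Qed.

Lemma mxtrace_regularE (x : gT) : x \in G -> \tr (aG x) = #|G|%:R *+ (x == 1%g).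
Proof.
move=> Gx; have [-> | ntx] := eqVneq x 1%g; first by rewrite repr_mx1 mxtrace1.
rewrite [\tr _]big1 // => i _; rewrite 2!mxE /=.
rewrite -(inj_eq enum_val_inj) gring_indexK ?groupM ?enum_valP //.
by rewrite eq_mulVg1 mulKg (negbTE ntx).
Qed.

Context (sG : irrType K G).
Local Notation psi i := (character_of (irr_repr i : mx_representation K G _)).

(** The central idempotent of one irreducible module has trace equal to its
    degree there, nonzero in characteristic [0], and trace [0] on the others. *)
Lemma irr_characters_inj : injective (fun i : sG => psi i).
Proof.
move=> i j eq_ij; apply: contrapT => /eqP ne_ij.
have e_i_R : (Wedderburn_id i \in R_G)%MS.
  rewrite -(Wedderburn_sum_pchar sG char0_pgroup).
  by rewrite (sumsmx_sup i) ?Wedderburn_id_mem.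
have eq_tr A : (A \in R_G)%MS ->
    \tr (gring_op (irr_repr i) A) = \tr (gring_op (irr_repr j) A).
  case/envelop_mxP=> a ->; rewrite !linear_sum; apply: eq_bigr => g Gg.
  rewrite !linearZ /= !gring_opG //; congr (_ * _).
  by have /ffunP/(_ g) := eq_ij; rewrite !ffunE Gg.
have := eq_tr _ e_i_R; rewrite (op_Wedderburn_id_pchar char0_pgroup).
rewrite (irr_repr'_op0_pchar char0_pgroup ne_ij) ?Wedderburn_id_mem //.
rewrite mxtrace1 linear0 => /eqP; rewrite (proj1 (pcharf0P K)) //.
by apply/negP; rewrite -lt0n irr_degree_gt0.
Qed.

Lemma Irr_irr_repr (chi : {ffun gT -> K}) :
  Irr K G chi <-> exists i : sG, chi = psi i.
Proof.
split=> [[n [rG [irrG ->]]] | [i ->]]; last first.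
  by exists (irr_degree i), (irr_repr i); split=> //; apply: socle_irr.
exists (irr_comp sG rG); apply/ffunP=> g; rewrite !ffunE; case: ifP => // Gg.
exact: mxtrace_rsim (rsim_irr_comp_pchar sG char0_pgroup irrG) g Gg.
Qed.

Lemma sum_Irr (f : {ffun gT -> K} -> K) :
  \sum_(chi \in Irr K G) f chi = \sum_(i : sG) f (psi i).
Proof.
rewrite (fsbigE [seq psi i | i <- enum {: sG}]).
- rewrite big_map big_enum_cond; apply: eq_bigl => i; rewrite inE.
  by apply/asboolP; apply/Irr_irr_repr; exists i.
- by rewrite map_inj_uniq ?enum_uniq //; apply: irr_characters_inj.
- by move=> chi /= /mapP[i _ ->]; apply/Irr_irr_repr; exists i.
- move=> chi /Irr_irr_repr[i ->] /negP[]; apply/mapP; exists i => //.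
  by rewrite mem_enum.
Qed.

(** The element [z] with coefficients [alpha (g^-1)] is central, so by Schur it
    acts on an irreducible module of degree [n] by a scalar [l], where [n l] is
    [#|G|] times the product of [alpha] with the character. Now compute the
    trace of [z h] on the regular module twice: directly, and by decomposing it
    into [n] copies of each irreducible module. *)
Lemma class_function_expansion (alpha : {ffun gT -> K}) (h : gT) :
  {in G &, forall x y, alpha (x ^ y)%g = alpha x} -> h \in G ->
  alpha h = \sum_(i : sG) cf_dot G alpha (psi i) * psi i h.
Proof.
move=> alphaJ Gh; pose z := \sum_(g in G) alpha (g^-1)%g *: aG g.
have nzG : #|G|%:R != 0 :> K.
  by rewrite (proj1 (pcharf0P K)) // -lt0n cardG_gt0.
apply: (mulfI nzG).
transitivity (\tr (z *m aG h)).
  rewrite mulmx_suml linear_sum (bigD1 (h^-1)%g) ?groupV //=.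
  rewrite big1 => [|g /andP[Gg ne]].
    rewrite -scalemxAl linearZ /= -repr_mxM ?groupV // mulVg repr_mx1 invgK.
    by rewrite mxtrace1 addr0 mulrC.
  rewrite -scalemxAl linearZ /= -repr_mxM // mxtrace_regularE ?groupM //.
  by rewrite -{1}[h]invgK -eq_mulgV1 (negPf ne) mulr0n mulr0.
have traceA A : (A \in R_G)%MS ->
    \tr A = \sum_(i : sG) \tr (gring_op (irr_repr i) A) *+ irr_degree i.
  case/envelop_mxP=> a ->; rewrite linear_sum.
  transitivity (\sum_(g in G) \sum_(i : sG)
                  \tr (a g *: irr_repr i g) *+ irr_degree i).
    apply: eq_bigr => g Gg; rewrite linearZ /=.
    rewrite (mxtrace_regular_pchar sG char0_pgroup) //.
    by rewrite mulr_sumr; apply: eq_bigr => i _; rewrite linearZ /= mulrnAr.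
  rewrite exchange_big; apply: eq_bigr => i _; rewrite !linear_sum -sumrMnl.
  by apply: eq_bigr => g Gg; rewrite !linearZ /= gring_opG.
have Rz : (z \in R_G)%MS by apply/envelop_mxP; exists (fun g => alpha (g^-1)%g).
rewrite traceA ?envelop_mxM ?envelop_mx_id // mulr_sumr; apply: eq_bigr => i _.
rewrite gring_opM ?envelop_mx_id // gring_opG //.
pose zi := gring_op (irr_repr i) z.
have ziE : zi = \sum_(g in G) alpha (g^-1)%g *: irr_repr i g.
  rewrite /zi linear_sum; apply: eq_bigr => g Gg.
  by rewrite linearZ /= gring_opG.
have /is_scalar_mxP[l z_l] : is_scalar_mx zi.
  apply: (mx_abs_irr_cent_scalar (K_splitting _ _ (socle_irr i))).
  apply/centgmxP=> x Gx; rewrite ziE mulmx_suml mulmx_sumr.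
  rewrite [RHS](reindex_acts 'J _ Gx) ?astabsJ ?normG //=.
  apply: eq_bigr => g Gg.
  rewrite -scalemxAl -scalemxAr -conjVg alphaJ ?groupV //.
  by rewrite -!repr_mxM ?groupJ // -conjgC.
have deg_l : l *+ irr_degree i = #|G|%:R * cf_dot G alpha (psi i).
  rewrite -mxtrace_scalar -z_l ziE linear_sum /cf_dot mulrA mulfV // mul1r.
  rewrite (reindex_inj invg_inj).
  apply: eq_big => [g | g Gg]; first by rewrite groupV.
  rewrite linearZ /= ffunE invgK; congr (_ * _).
  by rewrite ifT // -groupV.
rewrite -/zi z_l mul_scalar_mx linearZ /= -mulrnAl deg_l -mulrA.
by rewrite [psi i h]ffunE Gh.
Qed.

End OrdinaryCharacters.

(** * Decomposition numbers *)

Section Decomposition.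
Context {p : nat} (S : modular_system p).
Context {gT : finGroupType} {G : {group gT}}.
Hypothesis S_splitting : splitting_for S G.
Local Notation K := (ms_K S).
Local Notation F := (ms_F S).

(** The simple modules are composition factors of the regular module; keeping
    one factor of each isomorphism class gives a finite system of
    representatives. *)
Lemma simple_modules_exist :
  exists (I : finType) (m : I -> nat) (M : forall i, mx_representation F G (m i))
         (beta : I -> {ffun gT -> K}),
    [/\ forall i, mx_irreducible (M i),
        forall i, has_brauer_character (M i) (beta i),
        forall i j, mx_rsim (M i) (M j) -> i = j &
        forall n (rL : mx_representation F G n), mx_irreducible rL ->
          exists i, mx_rsim rL (M i)].
Proof.
have [V [compV V1]] := composition_series_exists _ _ _ _ (regular_repr F G).
pose M_ (j : 'I_(size V)) := series_repr j compV.
(* The least index of a factor isomorphic to the given one; [odflt] never uses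
   its default value. *)
pose rep j := odflt j [pick i | `[< mx_rsim (M_ i) (M_ j) >]].
have repP j : mx_rsim (M_ j) (M_ (rep j)).
  rewrite /rep; case: pickP => [i /asboolP sim | _]; first exact: mx_rsim_sym.
  exact: mx_rsim_refl.
have rep_eq i j : mx_rsim (M_ i) (M_ j) -> rep i = rep j.
  move=> sim; rewrite /rep.
  have eq_P : (fun k => `[< mx_rsim (M_ k) (M_ i) >])
      =1 (fun k => `[< mx_rsim (M_ k) (M_ j) >]).
    move=> k; apply/asboolP/asboolP => sim_k; apply: mx_rsim_trans sim_k _ => //.
    exact: mx_rsim_sym.
  rewrite (eq_pick eq_P); case: pickP => // /(_ j) /asboolP[].
  exact: mx_rsim_refl.
pose I := {j : 'I_(size V) | rep j == j}.
pose M (i : I) := M_ (val i).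
have irrM i : mx_irreducible (M i) by apply: mx_series_repr_irr.
have /choice[beta betaP] i : exists beta, has_brauer_character (M i) beta.
  exact: brauer_character_exists.
exists I, _, M, beta; split=> // [i j /rep_eq | n rL irrL].
  by rewrite (eqP (valP i)) (eqP (valP j)) => /val_inj.
have [j sim_j] := rsim_regular_series irrL compV V1.
have rep_j : rep (rep j) == rep j by apply/eqP/esym/rep_eq/repP.
by exists (exist _ (rep j) rep_j); apply: mx_rsim_trans sim_j (repP j).
Qed.

Lemma decomposition_number_exists (psi phi : {ffun gT -> K}) :
  Irr K G psi -> IBr S G phi -> exists d, is_decomposition_number G psi phi d.
Proof.
move=> [n [rG [_ ->]]] [m [rL [irrL brauerL]]].
have [rU formU] := R_form_exists S n rG.
have [V [compV V1]] :=
  composition_series_exists _ _ _ _ (map_repr (ms_red S) rU).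
by eexists; exists n, rU, m, rL; split=> //; exists V, compV; split.
Qed.

Context (I : finType) (m : I -> nat).
Context (M : forall i, mx_representation F G (m i)).
Context (beta : I -> {ffun gT -> K}).
Hypothesis brauerM : forall i, has_brauer_character (M i) (beta i).
Hypothesis M_inj : forall i j, mx_rsim (M i) (M j) -> i = j.
Hypothesis M_onto : forall n (rL : mx_representation F G n),
  mx_irreducible rL -> exists i, mx_rsim rL (M i).

(** The integral form, the module affording [phi] and the composition series
    behind the decomposition number are arbitrary. Count the factors of that
    series by isomorphism class: the class of [M i0] is counted by the
    decomposition number, since a simple module affording [phi] is isomorphic
    to [M i0]. *)
Lemma brauer_decomposition (phi : {ffun gT -> K}) (i0 : I) n0
    (rL0 : mx_representation F G n0) (psi : {ffun gT -> K}) :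
  mx_irreducible rL0 -> has_brauer_character rL0 phi -> mx_rsim rL0 (M i0) ->
  Irr K G psi ->
  exists c : I -> nat, c i0 = decomposition_number G psi phi /\
    forall g, g \in G -> p_regular p g -> psi g = \sum_i (c i)%:R * beta i g.
Proof.
move=> irrL0 brauerL0 sim0 irr_psi.
have phi_ibr : IBr S G phi by exists n0, rL0.
have := xgetPex 0%N (decomposition_number_exists psi phi irr_psi phi_ibr).
rewrite -/(decomposition_number G psi phi).
move=> [n [rU [k [rL [formU irrL brauerL [V [compV [V1 ->]]]]]]]].
have /choice[f sim_f] (j : 'I_(size V)) :
    exists i, mx_rsim (series_repr j compV) (M i).
  exact/M_onto/mx_series_repr_irr.
have simL : mx_rsim rL (M i0).
  apply: mx_rsim_trans sim0.
  exact: (brauer_character_inj S S_splitting) brauerL0.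
exists (fun i => #|[pred j | f j == i]|); split=> [|g Gg reg_g].
  apply: eq_card => j; rewrite !inE; apply/eqP/asboolP=> [f_j | sim_j].
    rewrite -f_j in simL; exact: mx_rsim_trans (sim_f j) (mx_rsim_sym simL).
  apply: M_inj; apply: mx_rsim_trans (mx_rsim_sym (sim_f j)) _.
  exact: mx_rsim_trans sim_j simL.
transitivity (\sum_(j < size V) beta (f j) g).
  have [splitg _] := splitting_cycle S S_splitting g Gg.
  rewrite -formU ffunE Gg.
  apply: (lifted_trace_series S compV V1 g #[g]%g) => //.
    exact: lifted_trace_reduction.
  move=> j; apply: lifted_trace_rsim (mx_rsim_sym (sim_f j)) (Gg) _.
  exact: brauer_characterP (brauerM _) _ _.
rewrite (partition_big f xpredT) //=; apply: eq_bigr => i _.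
rewrite (eq_bigr (fun=> beta i g)) => [|j /eqP -> //].
by rewrite sumr_const mulr_natl.
Qed.

End Decomposition.

Lemma cf_pow_class_function (p : nat) (K : fieldType) (gT : finGroupType)
    (G : {group gT}) (chi : {ffun gT -> K}) : Irr K G chi ->
  {in G &, forall x y, cf_pow G p chi (x ^ y)%g = cf_pow G p chi x}.
Proof.
move=> [n [rG [_ ->]]] x y Gx Gy; rewrite !ffunE groupJ // Gx -conjXg.
have Gxp : (x ^+ p)%g \in G by rewrite groupX.
rewrite groupJ // Gxp conjgE !repr_mxM ?groupM ?groupV //.
by rewrite mxtrace_mulC -mulmxA -repr_mxM ?groupV // mulgV repr_mx1 mulmx1.
Qed.

Theorem proposition3p3 (p : nat) (p_prime : prime p)
    (S : modular_system p) (gT : finGroupType) (G : {group gT})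
    (S_splitting : splitting_for S G)
    (chi : {ffun gT -> ms_K S}) (chi_irr : Irr (ms_K S) G chi)
    (chi_pow : forall g : gT, g \in G -> p_regular p g -> chi (g ^+ p)%g = chi g)
    (phi : {ffun gT -> ms_K S}) (phi_ibr : IBr S G phi) :
  let a (psi : {ffun gT -> ms_K S}) := cf_dot G (cf_pow G p chi) psi in
  (decomposition_number G chi phi)%:R
  = \sum_(psi \in Irr (ms_K S) G) a psi * (decomposition_number G psi phi)%:R.
Proof.
move=> a; have K_char0 := ms_K_char0 S.
have [K_split _] := S_splitting G (subxx G).
have [I [m [M [beta [irrM brauerM M_inj M_onto]]]]] :=
  simple_modules_exist S S_splitting.
have [n0 [rL0 [irrL0 brauerL0]]] := phi_ibr.
have [i0 sim0] := M_onto _ _ irrL0.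
have decompose psi := brauer_decomposition S S_splitting I m M beta brauerM
  M_inj M_onto phi i0 n0 rL0 psi irrL0 brauerL0 sim0.
apply/asboolP; apply: (@socle_exists _ _ _ _ (regular_repr (ms_K S) G)) => sG.
apply/asboolP; rewrite (sum_Irr K_char0 sG).
pose psi i : {ffun gT -> ms_K S} := character_of (irr_repr (i : sG)).
have psi_irr i : Irr (ms_K S) G (psi i).
  by apply/(Irr_irr_repr K_char0 sG); exists i.
have [c [c_i0 chiE]] := decompose chi chi_irr.
have /choice[d dE] i := decompose (psi i) (psi_irr i).
pose x j : ms_K S := (c j)%:R - \sum_(i : sG) a (psi i) * (d i j)%:R.
have x0 : forall j, x j = 0.
  move=> j.
  apply: (brauer_characters_independent S S_splitting I xpredT m M beta x) => //.
    by move=> i k _ _; apply: M_inj.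
  move=> g Gg reg_g.
  transitivity (chi g - \sum_(i : sG) a (psi i) * psi i g).
    rewrite (chiE g) //.
    rewrite (eq_bigr (fun i => \sum_k a (psi i) * (d i k)%:R * beta k g)).
      rewrite exchange_big -sumrB; apply: eq_bigr => k _.
      by rewrite mulrBl mulr_suml.
    move=> i _; have [_ ->] := dE i; rewrite // mulr_sumr.
    by apply: eq_bigr => k _; rewrite mulrA.
  rewrite -(class_function_expansion K_char0 K_split sG) //.
    by rewrite ffunE Gg chi_pow // subrr.
  exact: cf_pow_class_function.
have /eqP := x0 i0; rewrite subr_eq0 c_i0 => /eqP ->.
by apply: eq_bigr => i _; have [-> _] := dE i.
Qed.
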